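(* Let $\mathbb{F}$ be a field of characteristic different from $2$ and let $u,v\in\mathbb{F}^\times=\mathbb{F}\setminus\{0\}$ be such that $u\neq v$. Then $D_u\sim D_v$ if and only if $\frac{u}{v}$ is a square in $\mathbb{F}$, where $$D_{w}=\begin{pmatrix}0&0&0&0\\ 0&0&0&0\\ 1&1&0&0\\ w&1&0&0\end{pmatrix}\quad(w\in\mathbb{F}^\times).$$
   Context: For a strictly lower triangular $n\times n$ matrix $T=[t_{ij}]$ ($n\geq 2$) over a field $\mathbb{F}$ of characteristic different from $2$, $\mathcal{A}(T)$ is the commutative (unital, associative) $\mathbb{F}$-algebra given by generators $X_1,\dots,X_n$ and relations $X_1^2=0$ and $X_i^2=\sum_{j<i}t_{ij}X_jX_i$ for $2\leq i\leq n$; it is graded by $\deg(X_i)=2$. For two such $n\times n$ matrices write $T\sim S$ if there is a degree preserving isomorphism of graded $\mathbb{F}$-algebras $\mathcal{A}(T)\to\mathcal{A}(S)$. *)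

(* Defs.v *)
From HB Require Import structures.
From mathcomp Require Import all_boot all_order all_algebra.
From mathcomp Require Import generic_quotient ring_quotient.
From mathcomp Require Import boolp.
From mathcomp Require Import mpoly.

Set Implicit Arguments.
Unset Strict Implicit.
Unset Printing Implicit Defensive.

Import GRing.Theory.

Local Open Scope ring_scope.
Local Open Scope quotient_scope.

Definition strictly_lower (F : fieldType) (n : nat) (T : 'M[F]_n) : Prop :=
  forall i j : 'I_n, (i <= j)%N -> T i j = 0.

Section PresentedAlgebra.

Variables (F : fieldType) (n : nat) (T : 'M[F]_n).

(* For the first index the sum is empty, so this is the relation X_1^2 = 0.
   Entries of T on or above the diagonal are never read. *)
Definition relator (i : 'I_n) : {mpoly F[n]} :=
  'X_i ^+ 2 - \sum_(j < n | (j < i)%N) T i j *: ('X_j * 'X_i).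

(* Membership in the ideal generated by the relators, as a boolean predicate
   (classically) because ring_quotient asks for one. *)
Definition relideal : {pred {mpoly F[n]}} :=
  fun p => `[< exists c : 'I_n -> {mpoly F[n]}, p = \sum_i c i * relator i >].

Lemma relator0 i : (relator i).@[fun=> 0] = 0.
Proof.
have sum0 : (\sum_(j < n | (j < i)%N) T i j *: ('X_j * 'X_i)).@[fun=> 0] = 0.
  rewrite raddf_sum big1 // => j _ /=.
  by rewrite mevalZ mevalM !mevalXU !mulr0.
by rewrite /relator mevalB sum0 subr0 rmorphXn /= mevalXU expr0n.
Qed.

Lemma relideal_closed : idealr_closed relideal.
Proof.
split.
- by apply/asboolP; exists (fun=> 0); rewrite big1 // => i _; rewrite mul0r.
- apply/asboolP => -[c] /(congr1 (meval (fun=> 0))) /eqP.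
  rewrite meval1 raddf_sum big1 ?oner_eq0 //= => i _.
  by rewrite mevalM relator0 mulr0.
- move=> a u v /asboolP[c ->] /asboolP[d ->]; apply/asboolP.
  exists (fun i => a * c i + d i).
  by rewrite mulr_sumr -big_split; apply: eq_bigr => i _; rewrite mulrDl mulrA.
Qed.

HB.instance Definition _ := isIdealr.Build {mpoly F[n]} relideal relideal_closed.

Definition presalg : Type := {ideal_quot relideal}.

HB.instance Definition _ := GRing.ComNzRing.on presalg.

Definition presalg_pi (p : {mpoly F[n]}) : presalg :=
  \pi_({ideal_quot relideal}) p.

Definition presalg_scale (a : F) (x : presalg) : presalg := presalg_pi a%:MP * x.

Lemma presalg_piM : {morph presalg_pi : x y / x * y}. Proof. exact: rmorphM. Qed.
Lemma presalg_piD : {morph presalg_pi : x y / x + y}. Proof. exact: rmorphD. Qed.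
Lemma presalg_pi1 : presalg_pi 1 = 1. Proof. exact: rmorph1. Qed.

Lemma presalg_scaleA a b x :
  presalg_scale a (presalg_scale b x) = presalg_scale (a * b) x.
Proof. by rewrite /presalg_scale mulrA -presalg_piM mpolyCM. Qed.

Lemma presalg_scale1 : left_id 1 presalg_scale.
Proof. by move=> x; rewrite /presalg_scale presalg_pi1 mul1r. Qed.

Lemma presalg_scaleDr : right_distributive presalg_scale +%R.
Proof. by move=> a x y; rewrite /presalg_scale mulrDr. Qed.

Lemma presalg_scaleDl x : {morph presalg_scale^~ x : a b / a + b}.
Proof. by move=> a b; rewrite /presalg_scale mpolyCD presalg_piD mulrDl. Qed.

HB.instance Definition _ :=
  GRing.Zmodule_isLmodule.Build F presalg
    presalg_scaleA presalg_scale1 presalg_scaleDr presalg_scaleDl.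

Lemma presalg_scaleAl (a : F) (x y : presalg) : a *: (x * y) = (a *: x) * y.
Proof. exact: mulrA. Qed.

HB.instance Definition _ := GRing.Lmodule_isLalgebra.Build F presalg presalg_scaleAl.

Lemma presalg_scaleAr (a : F) (x y : presalg) : a *: (x * y) = x * (a *: y).
Proof. exact: mulrCA. Qed.

HB.instance Definition _ := GRing.Lalgebra_isAlgebra.Build F presalg presalg_scaleAr.

(* Homogeneous component of degree k for the grading with deg X_i = 2. *)
Definition homog_component (k : nat) (x : presalg) : Prop :=
  exists2 p : {mpoly F[n]},
    {in msupp p, forall m, (2 * mdeg m)%N = k} & x = presalg_pi p.

End PresentedAlgebra.

Definition graded_iso (F : fieldType) (n : nat) (T S : 'M[F]_n) : Prop :=
  exists2 phi : {lrmorphism presalg T -> presalg S}, bijective phi &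
    forall (k : nat) (x : presalg T),
      homog_component k x -> homog_component k (phi x).

Definition Dmx (F : fieldType) (w : F) : 'M[F]_4 :=
  \matrix_(i < 4, j < 4)
    nth 0 (nth [::] [:: [:: 0; 0; 0; 0];
                        [:: 0; 0; 0; 0];
                        [:: 1; 1; 0; 0];
                        [:: w; 1; 0; 0]] i) j.

Lemma Dmx_strictly_lower (F : fieldType) (w : F) : strictly_lower (Dmx w).
Proof. by do 2!case=> [[|[|[|[|//]]]] ?] //; rewrite mxE. Qed.

(* Main.v *)
(* Completing the squares, y_3 = 2 X_3 - X_1 - X_2 and y_4 = 2 X_4 - w X_1 - X_2 satisfy
   y_3^2 = 2 X_1 X_2 and y_4^2 = 2 w X_1 X_2 in A(D_w).  If u = a^2 v, rescaling y_4 by a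
   therefore gives an isomorphism.  Conversely, the squarefree monomials X_i X_j are linearly
   independent in A(D_w), so an element of degree 2 whose square is a multiple of X_1 X_2
   lies in the span of X_1 and X_2, or is a multiple of y_3 or of y_4.  An isomorphism
   A(D_u) -> A(D_v) thus preserves span(X_1, X_2), acts on X_1 X_2 by a scalar, and either
   preserves or swaps the lines of y_3 and y_4; comparing squares makes u / v, respectively
   u v, a square. *)

Require Import Defs.
From HB Require Import structures.
From mathcomp Require Import all_boot all_order all_algebra.
From mathcomp Require Import generic_quotient ring_quotient boolp mpoly ring.

Set Implicit Arguments.
Unset Strict Implicit.
Unset Printing Implicit Defensive.

Import GRing.Theory.
Local Open Scope ring_scope.
Local Open Scope quotient_scope.

(** * Maps out of A(T) and isomorphisms given by linear substitutions *)

Section PresentedAlgebraTheory.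

Variables (F : fieldType) (n : nat).
Implicit Types (T S : 'M[F]_n) (p q : {mpoly F[n]}).

Lemma presalg_pi_is_linear T : linear (presalg_pi T).
Proof. by move=> a p q; rewrite presalg_piD -mul_mpolyC presalg_piM. Qed.

HB.instance Definition _ T :=
  GRing.isLinear.Build F {mpoly F[n]} (presalg T) _ (presalg_pi T)
    (presalg_pi_is_linear T).

Lemma presalg_piZ T a p : presalg_pi T (a *: p) = a *: presalg_pi T p.
Proof. exact: linearZ. Qed.

Lemma presalg_pi_is_monoid_morphism T : monoid_morphism (presalg_pi T).
Proof. by split; [exact: presalg_pi1 | exact: presalg_piM]. Qed.

HB.instance Definition _ T :=
  GRing.isMonoidMorphism.Build {mpoly F[n]} (presalg T) (presalg_pi T)
    (presalg_pi_is_monoid_morphism T).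

Lemma presalg_reprK T (x : presalg T) : presalg_pi T (repr x) = x.
Proof. exact: (@reprK _ {ideal_quot (relideal T)}). Qed.

Lemma presalg_pi_eq0 T p :
  presalg_pi T p = 0 <-> exists c : 'I_n -> {mpoly F[n]}, p = \sum_i c i * relator T i.
Proof.
rewrite -[p in X in _ <-> X]subr0 -[0 in X in X <-> _](rmorph0 (presalg_pi T)).
split.
  by move/eqP; rewrite /presalg_pi -Quotient.idealrBE => /asboolP.
by move=> c_p; apply/eqP; rewrite /presalg_pi -Quotient.idealrBE; apply/asboolP.
Qed.

Lemma presalg_pi_relator T i : presalg_pi T (relator T i) = 0.
Proof.
apply/presalg_pi_eq0; exists (fun k => (k == i)%:R).
by rewrite (bigD1 i) //= eqxx mul1r big1 ?addr0 // => k /negPf->; rewrite mul0r.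
Qed.

Lemma presalg_piZ_relator T a i : presalg_pi T (a *: relator T i) = 0.
Proof. by rewrite presalg_piZ presalg_pi_relator scaler0. Qed.

(** Universal property of the presentation. The factored map is [f] on the chosen representative;
    two representatives differ by a combination of relators, which [f] kills. *)
Lemma presalg_lift T (B : comAlgType F) (f : {lrmorphism {mpoly F[n]} -> B}) :
    (forall i, f (relator T i) = 0) ->
  exists phi : {lrmorphism presalg T -> B}, forall p, phi (presalg_pi T p) = f p.
Proof.
move=> f_rel; pose g (x : presalg T) := f (repr x).
have gE p : g (presalg_pi T p) = f p.
  apply/eqP; rewrite -subr_eq0 -rmorphB; apply/eqP.
  have [|c ->] := (presalg_pi_eq0 T (repr (presalg_pi T p) - p)).1.
    by rewrite rmorphB /= presalg_reprK subrr.
  by rewrite rmorph_sum big1 // => i _; rewrite rmorphM /= f_rel mulr0.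
have g_lin : linear g.
  move=> a x y; rewrite -[x]presalg_reprK -[y]presalg_reprK -linearP !gE.
  exact: linearP.
have g_mon : monoid_morphism g.
  split=> [|x y]; first by rewrite -(rmorph1 (presalg_pi T)) gE rmorph1.
  by rewrite -[x]presalg_reprK -[y]presalg_reprK -rmorphM !gE rmorphM.
pose gL := GRing.isLinear.Build F _ _ _ g g_lin.
pose gM := GRing.isMonoidMorphism.Build _ _ g g_mon.
by exists (HB.pack_for {lrmorphism presalg T -> B} g gL gM).
Qed.

Lemma dhomog_comp_mpoly d p (lq : n.-tuple {mpoly F[n]}) :
    (forall i, tnth lq i \is 1.-homog) ->
  p \is d.-homog -> p \mPo lq \is d.-homog.
Proof.
move=> lq_hom /dhomogP p_hom; rewrite comp_mpolyE big_seq rpred_sum // => m /p_hom <-.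
apply: dhomogZ; rewrite [X in X.-homog]mdegE.
elim/big_ind2: _ => [|? ? ? ?|i _]; [exact: dhomog1 | exact: dhomogM |].
by have := dhomogMn (m i) (lq_hom i); rewrite mul1n.
Qed.

Lemma comp_mpolyK (lq lr : n.-tuple {mpoly F[n]}) :
  (forall i, tnth lq i \mPo lr = 'X_i) -> cancel (comp_mpoly lq) (comp_mpoly lr).
Proof.
move=> lqK p; rewrite [RHS]mpolyE (comp_mpolyE p) raddf_sum; apply: eq_bigr => m _ /=.
rewrite linearZ rmorph_prod mpolyXE_id; congr (_ *: _).
by apply: eq_bigr => i _; rewrite rmorphXn /= lqK.
Qed.

(** Reduces an isomorphism to finitely many polynomial checks: the substitutions [lq] and [lr]
    descend to the quotients, and being inverse to each other is tested on the variables. *)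
Lemma graded_iso_subst T S (lq lr : n.-tuple {mpoly F[n]}) :
    (forall i, tnth lq i \is 1.-homog) ->
    (forall i, presalg_pi S (relator T i \mPo lq) = 0) ->
    (forall i, presalg_pi T (relator S i \mPo lr) = 0) ->
    (forall i, tnth lq i \mPo lr = 'X_i) ->
    (forall i, tnth lr i \mPo lq = 'X_i) ->
  graded_iso T S.
Proof.
move=> lq_hom lq_rel lr_rel lqK lrK.
have [phi phiE] := presalg_lift (f := presalg_pi S \o comp_mpoly lq) lq_rel.
have [psi psiE] := presalg_lift (f := presalg_pi T \o comp_mpoly lr) lr_rel.
exists phi => [|k _ [p p_hom ->]].
  exists psi => x; rewrite -[x]presalg_reprK.
    by rewrite phiE /= psiE /= comp_mpolyK.
  by rewrite psiE /= phiE /= comp_mpolyK.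
exists (p \mPo lq); last exact: phiE.
(* Since deg X_i = 2, only the zero polynomial represents an element of odd degree. *)
have [k_odd|k_even] := boolP (odd k).
  suff ->: p = 0 by rewrite comp_mpoly0 => m; rewrite msupp0.
  apply/eqP; rewrite -msupp_eq0; case: (msupp p) p_hom => // m s /(_ m (mem_head _ _)).
  by move=> k_m; rewrite -k_m mul2n odd_double in k_odd.
have p_homog : p \is (k./2).-homog.
  by apply/dhomogP => m /p_hom <-; rewrite mul2n doubleK.
move=> m m_p; rewrite (dhomogP _ _ _ (dhomog_comp_mpoly lq_hom p_homog) m m_p).
by rewrite mul2n even_halfK.
Qed.

(** * Linear independence in A(T) through derivatives at the origin *)

Definition grad0 (i : 'I_n) p : F := (p^`M(i)).@[fun=> 0].

(** Derivatives at the origin stand in for coefficients of degree one and two, because the Leibniz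
    rule evaluates them directly on combinations of relators. For [i = j] the value is twice the
    coefficient of X_i^2. *)
Definition hess0 (i j : 'I_n) p : F := (p^`M(i)^`M(j)).@[fun=> 0].

Arguments grad0 : simpl never.
Arguments hess0 : simpl never.

Lemma grad0_is_linear i : linear_for *%R (grad0 i).
Proof. by move=> a p q; rewrite /grad0 mderivD mderivZ mevalD mevalZ. Qed.

HB.instance Definition _ i :=
  GRing.isLinear.Build F {mpoly F[n]} F _ (grad0 i) (grad0_is_linear i).

Lemma hess0_is_linear i j : linear_for *%R (hess0 i j).
Proof. by move=> a p q; rewrite /hess0 !(mderivD, mderivZ) mevalD mevalZ. Qed.

HB.instance Definition _ i j :=
  GRing.isLinear.Build F {mpoly F[n]} F _ (hess0 i j) (hess0_is_linear i j).

Lemma grad0M i p q :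
  grad0 i (p * q) = grad0 i p * q.@[fun=> 0] + p.@[fun=> 0] * grad0 i q.
Proof. by rewrite /grad0 mderivM mevalD !mevalM. Qed.

Lemma hess0M i j p q :
  hess0 i j (p * q) = hess0 i j p * q.@[fun=> 0] + grad0 i p * grad0 j q
                    + (grad0 j p * grad0 i q + p.@[fun=> 0] * hess0 i j q).
Proof. by rewrite /hess0 /grad0 mderivM mderivD !mderivM !mevalD !mevalM. Qed.

Lemma grad0X i k : grad0 i 'X_k = (k == i)%:R.
Proof.
rewrite /grad0 mderivX mnm1E mevalZ; case: eqP => [->|_]; last by rewrite mul0r.
by rewrite -{1}[U_(i)%MM]add0m addmK mpolyX0 meval1 mulr1.
Qed.

Lemma hess0XX i j k l :
  hess0 i j ('X_k * 'X_l) = (k == i)%:R * (l == j)%:R + (k == j)%:R * (l == i)%:R.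
Proof. by rewrite hess0M !mevalXU !grad0X mulr0 mul0r add0r addr0. Qed.

Lemma grad0_relator T i k : grad0 i (relator T k) = 0.
Proof.
rewrite /relator linearB linear_sum /= expr2 grad0M mevalXU !mulr0 mul0r addr0 sub0r.
rewrite big1 ?oppr0 // => j _.
by rewrite linearZ /= grad0M !mevalXU !(mulr0, mul0r) addr0 mulr0.
Qed.

Lemma hess0_relator T i k : hess0 i i (relator T k) = 2 * (k == i)%:R.
Proof.
rewrite /relator linearB linear_sum /= big1 => [|j].
  rewrite subr0 expr2 hess0XX -!natrM mulnb andbb -natrD addnn -mul2n natrM //.
case: (eqVneq j k) => [->|j_k _]; first by rewrite ltnn.
rewrite linearZ /= hess0XX; case: (eqVneq j i) => [<-|_].
  by rewrite eq_sym (negPf j_k) !mulr0 addr0 mulr0.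
by rewrite !mul0r addr0 mulr0.
Qed.

(** Relators have neither constant nor linear terms. Hence the generators are linearly independent
    in A(T). *)
Lemma grad0_pi_eq0 T i p : presalg_pi T p = 0 -> grad0 i p = 0.
Proof.
move/presalg_pi_eq0 => [c ->]; rewrite linear_sum big1 // => k _ /=.
by rewrite grad0M grad0_relator relator0 !mulr0 addr0.
Qed.

(** Write p as a combination of relators with coefficients c_k. As X_k^2 is the only pure square in
    the k-th relator, the k-th diagonal second derivative is 2 c_k(0). If all of these vanish, so do
    the constant terms of the c_k, and with them the whole quadratic part of p. *)
Lemma hess0_pi_eq0 T i j p : (2 : F) != 0 -> presalg_pi T p = 0 ->
  (forall k, hess0 k k p = 0) -> hess0 i j p = 0.
Proof.
move=> nz2 /presalg_pi_eq0[c p_c] p_diag.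
have hessE k l : hess0 k l p = \sum_m (c m).@[fun=> 0] * hess0 k l (relator T m).
  rewrite p_c linear_sum; apply: eq_bigr => m _ /=.
  by rewrite hess0M !grad0_relator relator0 !mulr0 !add0r.
have c0 k : (c k).@[fun=> 0] = 0.
  move: (p_diag k); rewrite hessE (bigD1 k) //= big1 => [|m /negPf k_m].
    by rewrite hess0_relator eqxx mulr1 addr0 => /eqP; rewrite mulf_eq0 (negPf nz2) orbF => /eqP.
  by rewrite hess0_relator k_m !mulr0.
by rewrite hessE big1 // => m _; rewrite c0 mul0r.
Qed.

Lemma dhomog1_linear p : p \is 1.-homog -> p = \sum_i p@_U_(i) *: 'X_i.
Proof.
move=> p_hom; apply/mpolyP => m; rewrite raddf_sum /=.
have [/mdeg1P[j /eqP->]|deg_m] := boolP (mdeg m == 1%N).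
  rewrite (bigD1 j) //= linearZ /= mcoeffX eqxx mulr1 big1 ?addr0 // => i i_j.
  rewrite linearZ /= mcoeffX; case: eqP => [/mnmP/(_ j)|_]; last exact: mulr0.
  by rewrite !mnm1E eqxx (negPf i_j).
rewrite (dhomog_nemf_coeff p_hom deg_m) big1 // => i _.
rewrite linearZ /= mcoeffX; case: eqP => [m_i|_]; last exact: mulr0.
by rewrite -m_i mdeg1 in deg_m.
Qed.

End PresentedAlgebraTheory.

(** * Squares of degree 2 elements in A(D_w) *)

Section FourGenerators.

Variable F : fieldType.

(** The indices are spelled with [lift] to match the terms that [big_ord_recl] produces. *)
Local Notation i0 := (ord0 : 'I_4).
Local Notation i1 := (lift ord0 ord0 : 'I_4).
Local Notation i2 := (lift ord0 (lift ord0 ord0) : 'I_4).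
Local Notation i3 := (lift ord0 (lift ord0 (lift ord0 ord0)) : 'I_4).
(* Indices are 0-based: [X0], ..., [X3] are the generators X_1, ..., X_4. *)
Local Notation X0 := ('X_i0 : {mpoly F[4]}).
Local Notation X1 := ('X_i1 : {mpoly F[4]}).
Local Notation X2 := ('X_i2 : {mpoly F[4]}).
Local Notation X3 := ('X_i3 : {mpoly F[4]}).

Definition lin4 (a b c d : F) : {mpoly F[4]} := a *: X0 + b *: X1 + c *: X2 + d *: X3.

Lemma lin4_dhomog a b c d : lin4 a b c d \is 1.-homog.
Proof. by rewrite !rpredD // dhomogZ // dhomogX /= mdeg1. Qed.

Lemma homog_component_lin4 (T : 'M[F]_4) a b c d :
  homog_component 2 (presalg_pi T (lin4 a b c d)).
Proof.
exists (lin4 a b c d) => // m m_p.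
by rewrite (dhomogP _ _ _ (lin4_dhomog a b c d) m m_p).
Qed.

Lemma homog_component2 (T : 'M[F]_4) x : homog_component 2 x ->
  exists a b c d, x = presalg_pi T (lin4 a b c d).
Proof.
case=> p p_hom ->; have p1 : p \is 1.-homog.
  by apply/dhomogP => m /p_hom deg_m; apply/eqP; rewrite -(eqn_pmul2l (isT : 0 < 2)%N) deg_m.
exists p@_U_(i0), p@_U_(i1), p@_U_(i2), p@_U_(i3).
by rewrite [in LHS](dhomog1_linear p1) !big_ord_recl big_ord0 addr0 !addrA.
Qed.

Lemma lin4_pi_eq0 (T : 'M[F]_4) a b c d : presalg_pi T (lin4 a b c d) = 0 ->
  [/\ a = 0, b = 0, c = 0 & d = 0].
Proof.
move=> p0.
have g i := grad0_pi_eq0 i p0.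
move: (g i0) (g i1) (g i2) (g i3).
rewrite /lin4 !linearD !linearZ /= !grad0X !eqE /= !(mulr0, mulr1, addr0, add0r).
by [].
Qed.

Lemma relator_Dmx w :
  [/\ relator (Dmx w) i0 = X0 ^+ 2,
      relator (Dmx w) i1 = X1 ^+ 2,
      relator (Dmx w) i2 = X2 ^+ 2 - (X0 * X2 + X1 * X2) &
      relator (Dmx w) i3 = X3 ^+ 2 - (w *: (X0 * X3) + X1 * X3)].
Proof.
split; rewrite /relator big_mkcond !big_ord_recl big_ord0 /= ?mxE /=.
all: by rewrite ?scale0r ?scale1r !(addr0, add0r, subr0).
Qed.

(** A combination of squarefree monomials has zero diagonal second derivatives, so [hess0_pi_eq0]
    applies and the mixed ones read off the coefficients. *)
Lemma quad_pi_eq0 (T : 'M[F]_4) c01 c02 c12 c03 c13 c23 : (2 : F) != 0 ->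
  presalg_pi T (c01 *: (X0 * X1) + c02 *: (X0 * X2) + c12 *: (X1 * X2)
              + c03 *: (X0 * X3) + c13 *: (X1 * X3) + c23 *: (X2 * X3)) = 0 ->
  [/\ c01 = 0, c02 = 0 & c12 = 0] /\ [/\ c03 = 0, c13 = 0 & c23 = 0].
Proof.
set q := (X in presalg_pi T X); move=> nz2 q0.
have q_hess i j : hess0 i j q = 0.
  apply: hess0_pi_eq0 nz2 q0 _ => k; rewrite /q !linearD !linearZ /= !hess0XX.
  by case: k => [[|[|[|[|//]]]] k_lt]; rewrite !eqE /= ?(mul0r, mulr0, addr0).
move: (q_hess i0 i1) (q_hess i0 i2) (q_hess i1 i2) (q_hess i0 i3) (q_hess i1 i3) (q_hess i2 i3).
rewrite /q !linearD !linearZ /= !hess0XX !eqE /= !(mul0r, mulr0, mulr1, addr0, add0r).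
by do 6!move=> ->.
Qed.

Lemma sqr_lin4 v a b c d k : (2 : F) != 0 ->
  presalg_pi (Dmx v) (lin4 a b c d) ^+ 2 = k *: presalg_pi (Dmx v) (X0 * X1) ->
  [/\ 2 * a * b = k, c * (2 * a + c) = 0 & c * (2 * b + c) = 0] /\
  [/\ d * (2 * a + v * d) = 0, d * (2 * b + d) = 0 & c * d = 0].
Proof.
move=> nz2 /eqP; rewrite -rmorphXn -linearZ -subr_eq0 -rmorphB /= => /eqP sq.
have [r0 r1 r2 r3] := relator_Dmx v.
(* The squarefree normal form of the square minus [k *: (X0 * X1)]: each X_i^2 is eliminated by its
   relator. *)
set q := (2 * a * b - k) *: (X0 * X1) + (c * (2 * a + c)) *: (X0 * X2)
    + (c * (2 * b + c)) *: (X1 * X2) + (d * (2 * a + v * d)) *: (X0 * X3)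
    + (d * (2 * b + d)) *: (X1 * X3) + (2 * (c * d)) *: (X2 * X3).
have qE : q = lin4 a b c d ^+ 2 - k *: (X0 * X1)
    - (a ^+ 2 *: relator (Dmx v) i0 + b ^+ 2 *: relator (Dmx v) i1
       + c ^+ 2 *: relator (Dmx v) i2 + d ^+ 2 *: relator (Dmx v) i3).
  by rewrite r0 r1 r2 r3 /q /lin4 -!mul_mpolyC; ring.
have : presalg_pi (Dmx v) q = 0.
  by rewrite qE linearB /= sq !presalg_piD !presalg_piZ_relator !addr0 subr0.
move/(quad_pi_eq0 nz2).
case=> // -[/eqP]; rewrite subr_eq0 => /eqP -> -> -> [-> -> /eqP].
by rewrite mulf_eq0 (negPf nz2) /= => /eqP ->.
Qed.

(** The four elements are X_1, X_2, y_3 and y_4, a basis of the degree 2 part adapted to the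
    squares. *)
Lemma presalg_pi_sqr_completed u :
  [/\ presalg_pi (Dmx u) (lin4 1 0 0 0) ^+ 2 = 0,
      presalg_pi (Dmx u) (lin4 0 1 0 0) ^+ 2 = 0,
      presalg_pi (Dmx u) (lin4 (- 1) (- 1) 2 0) ^+ 2 = 2 *: presalg_pi (Dmx u) (X0 * X1) &
      presalg_pi (Dmx u) (lin4 (- u) (- 1) 0 2) ^+ 2 = (2 * u) *: presalg_pi (Dmx u) (X0 * X1)].
Proof.
have [r0 r1 r2 r3] := relator_Dmx u.
have E0 : lin4 1 0 0 0 ^+ 2 = 1 *: relator (Dmx u) i0.
  by rewrite r0 /lin4 -!mul_mpolyC; ring.
have E1 : lin4 0 1 0 0 ^+ 2 = 1 *: relator (Dmx u) i1.
  by rewrite r1 /lin4 -!mul_mpolyC; ring.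
have E2 : lin4 (- 1) (- 1) 2 0 ^+ 2 = 2 *: (X0 * X1) + 1 *: relator (Dmx u) i0
    + 1 *: relator (Dmx u) i1 + 4 *: relator (Dmx u) i2.
  by rewrite r0 r1 r2 /lin4 -!mul_mpolyC; ring.
have E3 : lin4 (- u) (- 1) 0 2 ^+ 2 = (2 * u) *: (X0 * X1) + (u ^+ 2) *: relator (Dmx u) i0
    + 1 *: relator (Dmx u) i1 + 4 *: relator (Dmx u) i3.
  by rewrite r0 r1 r3 /lin4 -!mul_mpolyC; ring.
by rewrite -!rmorphXn /= E0 E1 E2 E3 !presalg_piD !presalg_piZ_relator !addr0 !linearZ.
Qed.

Lemma lin4_comb a b c d a0 b0 c0 d0 a1 b1 c1 d1 a2 b2 c2 d2 a3 b3 c3 d3 :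
  a *: lin4 a0 b0 c0 d0 + b *: lin4 a1 b1 c1 d1 + c *: lin4 a2 b2 c2 d2 + d *: lin4 a3 b3 c3 d3
  = lin4 (a * a0 + b * a1 + c * a2 + d * a3) (a * b0 + b * b1 + c * b2 + d * b3)
         (a * c0 + b * c1 + c * c2 + d * c3) (a * d0 + b * d1 + c * d2 + d * d3).
Proof. by rewrite /lin4 -!mul_mpolyC; ring. Qed.

Lemma mul_lin2 v a b a' b' : presalg_pi (Dmx v) (lin4 a b 0 0) * presalg_pi (Dmx v) (lin4 a' b' 0 0)
  = (a * b' + b * a') *: presalg_pi (Dmx v) (X0 * X1).
Proof.
have [r0 r1 _ _] := relator_Dmx v.
have E : lin4 a b 0 0 * lin4 a' b' 0 0 = (a * b' + b * a') *: (X0 * X1)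
     + (a * a') *: relator (Dmx v) i0 + (b * b') *: relator (Dmx v) i1.
  by rewrite r0 r1 /lin4 -!mul_mpolyC; ring.
by rewrite -rmorphM /= E !presalg_piD !presalg_piZ_relator !addr0 presalg_piZ.
Qed.

(** The alternatives are the span of X_1 and X_2, the line of y_3 and the line of y_4; they arise
    from [c * d = 0]. The value of [2 * k] is the product of [2 * a] and [2 * b]. *)
Lemma sqr_lin4_cases v a b c d k : (2 : F) != 0 ->
  presalg_pi (Dmx v) (lin4 a b c d) ^+ 2 = k *: presalg_pi (Dmx v) (X0 * X1) ->
  [\/ c = 0 /\ d = 0,
      [/\ c != 0, d = 0, 2 * a = - c, 2 * b = - c & 2 * k = c ^+ 2] |
      [/\ c = 0, d != 0, 2 * a = - (v * d), 2 * b = - d & 2 * k = v * d ^+ 2]].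
Proof.
move=> nz2 /(sqr_lin4 nz2)[[<- ac bc] [ad bd cd]].
have [c0|nz_c] := eqVneq c 0.
  have [d0|nz_d] := eqVneq d 0; first by constructor 1.
  move/eqP: ad; rewrite mulf_eq0 (negPf nz_d) addr_eq0 => /eqP ad.
  move/eqP: bd; rewrite mulf_eq0 (negPf nz_d) addr_eq0 => /eqP bd.
  constructor 3; split=> //; rewrite [LHS](_ : _ = (2 * a) * (2 * b)); first by rewrite ad bd; ring.
  by ring.
move/eqP: ac; rewrite mulf_eq0 (negPf nz_c) addr_eq0 => /eqP ac.
move/eqP: bc; rewrite mulf_eq0 (negPf nz_c) addr_eq0 => /eqP bc.
move/eqP: cd; rewrite mulf_eq0 (negPf nz_c) => /eqP d0.
constructor 2; split=> //; rewrite [LHS](_ : _ = (2 * a) * (2 * b)); first by rewrite ac bc; ring.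
by ring.
Qed.

(* Three vectors of a plane satisfy the relation given by their 2 x 2 minors. *)
Lemma no_three_in_plane (a0 b0 a1 b1 a2 b2 : F) :
  ~ (forall x y z : F, x * a0 + y * a1 + z * a2 = 0 -> x * b0 + y * b1 + z * b2 = 0 ->
       [/\ x = 0, y = 0 & z = 0]).
Proof.
move=> inj.
have [_ _ det0] : [/\ a1 * b2 - a2 * b1 = 0, a2 * b0 - a0 * b2 = 0 & a0 * b1 - a1 * b0 = 0].
  by apply: inj; ring.
(* Once the minor of the first two vectors is zero, [(b1, - b0, 0)] and [(a1, - a0, 0)] are
   relations too. So these vectors vanish, and [(1, 0, 0)] is a relation. *)
have [b10 b00 _] : [/\ b1 = 0, - b0 = 0 & (0 : F) = 0].
  by apply: inj; last ring; rewrite -[RHS]det0; ring.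
have [a10 a00 _] : [/\ a1 = 0, - a0 = 0 & (0 : F) = 0].
  apply: inj; first ring.
  by transitivity (- (a0 * b1 - a1 * b0)); [ring | rewrite det0 oppr0].
move/eqP: a00; rewrite oppr_eq0 => /eqP a00; move/eqP: b00; rewrite oppr_eq0 => /eqP b00.
have [/eqP] : [/\ (1 : F) = 0, (0 : F) = 0 & (0 : F) = 0].
  by apply: inj; rewrite ?a00 ?b00; ring.
by rewrite oner_eq0.
Qed.

(** * An isomorphism forces u / v to be a square *)

Lemma graded_iso_Dmx_square (u v : F) : (2 : F) != 0 -> v != 0 ->
  graded_iso (Dmx u) (Dmx v) -> exists a : F, u / v = a ^+ 2.
Proof.
move=> nz2 nz_v [phi phi_bij phi_deg].
have phi_inj := bij_inj phi_bij.
have phiZ a x : phi (a *: x) = a *: phi x by exact: linearZ.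
have [sq0 sq1 sq2 sq3] := presalg_pi_sqr_completed u.
have phiE a b c d := homog_component2 (phi_deg 2 _ (homog_component_lin4 (Dmx u) a b c d)).
have [a0 [b0 [c0 [d0 E0]]]] := phiE 1 0 0 0.
have [a1 [b1 [c1 [d1 E1]]]] := phiE 0 1 0 0.
have [a2 [b2 [c2 [d2 E2]]]] := phiE (- 1) (- 1) 2 0.
have [a3 [b3 [c3 [d3 E3]]]] := phiE (- u) (- 1) 0 2.
(* The images of X_1, X_2, y_3 and y_4 are linearly independent, stated in coordinates. *)
have inj x y z t :
    x * a0 + y * a1 + z * a2 + t * a3 = 0 -> x * b0 + y * b1 + z * b2 + t * b3 = 0 ->
    x * c0 + y * c1 + z * c2 + t * c3 = 0 -> x * d0 + y * d1 + z * d2 + t * d3 = 0 ->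
  [/\ x = 0, y = 0, z = 0 & t = 0].
  move=> xa xb xc xd.
  have: presalg_pi (Dmx u) (x *: lin4 1 0 0 0 + y *: lin4 0 1 0 0
          + z *: lin4 (- 1) (- 1) 2 0 + t *: lin4 (- u) (- 1) 0 2) = 0.
    apply: phi_inj; rewrite rmorph0 !presalg_piD !presalg_piZ /=.
    rewrite !(rmorphD phi) /= !phiZ E0 E1 E2 E3.
    rewrite -!presalg_piZ -!presalg_piD lin4_comb xa xb xc xd.
    by rewrite /lin4 !scale0r !addr0 linear0.
  rewrite lin4_comb => /lin4_pi_eq0[].
  rewrite !(mulr0, mulr1, addr0, add0r) => xE yE /eqP zE /eqP tE.
  move: zE tE; rewrite !mulf_eq0 (negPf nz2) !orbF => /eqP z0 /eqP t0.
  by move: xE yE; rewrite z0 t0 !mul0r !addr0.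
have X0E : presalg_pi (Dmx u) (lin4 1 0 0 0) = presalg_pi (Dmx u) X0.
  by rewrite /lin4 scale1r !scale0r !addr0.
have X1E : presalg_pi (Dmx u) (lin4 0 1 0 0) = presalg_pi (Dmx u) X1.
  by rewrite /lin4 scale1r !scale0r !addr0 add0r.
(* Nonzero multiples of y_3 or y_4 have nonzero square, as [v] and 2 are nonzero. So the images of
   X_1 and X_2 stay in their span. *)
have sqr0_plane a b c d : presalg_pi (Dmx v) (lin4 a b c d) ^+ 2 = 0 -> c = 0 /\ d = 0.
  rewrite -(scale0r (presalg_pi (Dmx v) (X0 * X1))).
  by case/(sqr_lin4_cases nz2) => // -[nz_c nz_d _ _ /esym/eqP];
     rewrite mulr0 ?(sqrf_eq0, mulf_eq0) ?(negPf nz_c) ?(negPf nz_d) ?(negPf nz_v).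
have [c00 d00] : c0 = 0 /\ d0 = 0.
  by apply: (sqr0_plane a0 b0); rewrite -E0 -rmorphXn /= sq0 rmorph0.
have [c10 d10] : c1 = 0 /\ d1 = 0.
  by apply: (sqr0_plane a1 b1); rewrite -E1 -rmorphXn /= sq1 rmorph0.
subst c0 d0 c1 d1.
set k := a0 * b1 + b0 * a1.
have phi01 : phi (presalg_pi (Dmx u) (X0 * X1)) = k *: presalg_pi (Dmx v) (X0 * X1).
  by rewrite presalg_piM -X0E -X1E rmorphM /= E0 E1 mul_lin2.
have sq2' : presalg_pi (Dmx v) (lin4 a2 b2 c2 d2) ^+ 2 = (2 * k) *: presalg_pi (Dmx v) (X0 * X1).
  by rewrite -E2 -rmorphXn /= sq2 linearZ /= phi01 scalerA.
have sq3' : presalg_pi (Dmx v) (lin4 a3 b3 c3 d3) ^+ 2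
    = (2 * u * k) *: presalg_pi (Dmx v) (X0 * X1).
  by rewrite -E3 -rmorphXn /= sq3 linearZ /= phi01 scalerA.
have half0 (x : F) : 2 * x = 0 -> x = 0.
  by move/eqP; rewrite mulf_eq0 (negPf nz2) => /eqP.
(* The cases place the image of y_3 in the plane of X_1 and X_2, on the line of y_3, or on that of
   y_4. The plane already contains two independent images, so it has no room for a third. *)
case: (sqr_lin4_cases nz2 sq2') => [[c20 d20]|[nz2' d20 a2E b2E kE]|[c20 nz2' a2E b2E kE]].
- subst c2 d2.
  case: (@no_three_in_plane a0 b0 a1 b1 a2 b2) => x y z xa xb.
  by case: (inj x y z 0); rewrite ?mulr0 ?mul0r ?addr0 //.
- subst d2.
  case: (sqr_lin4_cases nz2 sq3') => [[c30 d30]|[nz3 d30 a3E b3E lE]|[c30 nz3 a3E b3E lE]].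
  + subst c3 d3; case: (@no_three_in_plane a0 b0 a1 b1 a3 b3) => x y z xa xb.
    by case: (inj x y 0 z); rewrite ?mulr0 ?mul0r ?addr0 //.
  (* Both images lie on the line of y_3, so [c3] times the first equals [c2] times the second,
     against independence. *)
  + have [||||_ _ _ /eqP] := inj 0 0 c3 (- c2); last by rewrite oppr_eq0 (negPf nz2').
    * by apply: half0; transitivity (c3 * (2 * a2) - c2 * (2 * a3)); [ring | rewrite a2E a3E; ring].
    * by apply: half0; transitivity (c3 * (2 * b2) - c2 * (2 * b3)); [ring | rewrite b2E b3E; ring].
    * by ring.
    * by rewrite d30; ring.
  (* Lines preserved: [4 * k = c2 ^+ 2] and [4 * u * k = v * d3 ^+ 2]. *)
  + exists (d3 / c2); have E : u * c2 ^+ 2 = v * d3 ^+ 2 by rewrite -kE -lE; ring.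
    apply: (mulIf nz_v); apply: (mulIf (expf_neq0 2 nz2')).
    by rewrite divfK // E; field.
- subst c2.
  case: (sqr_lin4_cases nz2 sq3') => [[c30 d30]|[nz3 d30 a3E b3E lE]|[c30 nz3 a3E b3E lE]].
  + subst c3 d3; case: (@no_three_in_plane a0 b0 a1 b1 a3 b3) => x y z xa xb.
    by case: (inj x y 0 z); rewrite ?mulr0 ?mul0r ?addr0 //.
  (* Lines swapped: [4 * k = v * d2 ^+ 2] and [4 * u * k = c3 ^+ 2], so u v is a square, and
     dividing by v^2 gives u / v. *)
  + exists (c3 / (d2 * v)); have E : u * v * d2 ^+ 2 = c3 ^+ 2.
      by rewrite -mulrA -kE -lE; ring.
    by rewrite expr_div_n -E; field; rewrite nz_v nz2'.
  + have [||||_ _ _ /eqP] := inj 0 0 d3 (- d2); last by rewrite oppr_eq0 (negPf nz2').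
    * by apply: half0; transitivity (d3 * (2 * a2) - d2 * (2 * a3)); [ring | rewrite a2E a3E; ring].
    * by apply: half0; transitivity (d3 * (2 * b2) - d2 * (2 * b3)); [ring | rewrite b2E b3E; ring].
    * by rewrite c30; ring.
    * by ring.
Qed.

(** * The isomorphism obtained from a square root of u / v *)

(* Fixes X_1, X_2, X_3 and sends X_4 - (u X_1 + X_2) / 2 to a (X_4 - (v X_1 + X_2) / 2). *)
Definition subst_last (u v a : F) : 4.-tuple {mpoly F[4]} :=
  [tuple X0; X1; X2; lin4 ((u - a * v) / 2) ((1 - a) / 2) 0 a].

Lemma ord4_ind (P : 'I_4 -> Prop) : P i0 -> P i1 -> P i2 -> P i3 -> forall i, P i.
Proof.
move=> P0 P1 P2 P3 i; case: (unliftP ord0 i) => [j ->|-> //].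
case: (unliftP ord0 j) => [k ->|-> //]; case: (unliftP ord0 k) => [l ->|-> //].
by rewrite ord1.
Qed.

Lemma subst_last_dhomog u v a i : tnth (subst_last u v a) i \is 1.-homog.
Proof.
by elim/ord4_ind: i; rewrite (tnth_nth 0) /= ?lin4_dhomog // dhomogX /= mdeg1.
Qed.

Lemma comp_subst_lastX u v a :
  [/\ X0 \mPo subst_last u v a = X0, X1 \mPo subst_last u v a = X1,
      X2 \mPo subst_last u v a = X2 &
      X3 \mPo subst_last u v a = lin4 ((u - a * v) / 2) ((1 - a) / 2) 0 a].
Proof. by rewrite !comp_mpolyXU. Qed.

(** Undoing the rescaling of y_4 exchanges [u] with [v] and inverts [a]; only the last variable
    needs a computation. *)
Lemma subst_lastK u v a i : (2 : F) != 0 -> a != 0 ->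
  tnth (subst_last u v a) i \mPo subst_last v u a^-1 = 'X_i.
Proof.
move=> nz2 nz_a; have [e0 e1 e2 e3] := comp_subst_lastX v u a^-1.
elim/ord4_ind: i; rewrite (tnth_nth 0) /= //.
have lin_X0 : X0 = lin4 1 0 0 0 by rewrite /lin4 !scale0r !addr0 scale1r.
have lin_X1 : X1 = lin4 0 1 0 0 by rewrite /lin4 !scale0r !addr0 add0r scale1r.
have lin_X2 : X2 = lin4 0 0 1 0 by rewrite /lin4 !scale0r addr0 !add0r scale1r.
have lin_X3 : X3 = lin4 0 0 0 1 by rewrite /lin4 !scale0r !add0r scale1r.
rewrite [X in X \mPo _]/lin4 !comp_mpolyD !comp_mpolyZ e0 e1 e2 e3.
by rewrite lin_X0 lin_X1 lin_X2 lin_X3 lin4_comb; congr lin4; field; rewrite ?nz_a ?nz2.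
Qed.

Lemma subst_last_relator (u v a : F) i : (2 : F) != 0 -> u = a ^+ 2 * v ->
  presalg_pi (Dmx v) (relator (Dmx u) i \mPo subst_last u v a) = 0.
Proof.
move=> nz2 uE; have [e0 e1 e2 e3] := comp_subst_lastX u v a.
have [r0 r1 r2 r3] := relator_Dmx u.
have [s0 s1 s2 s3] := relator_Dmx v.
have compM p q : (p * q) \mPo subst_last u v a
    = (p \mPo subst_last u v a) * (q \mPo subst_last u v a) by exact: rmorphM.
elim/ord4_ind: i.
- by rewrite r0 expr2 compM e0 -expr2 -s0 presalg_pi_relator.
- by rewrite r1 expr2 compM e1 -expr2 -s1 presalg_pi_relator.
- by rewrite r2 comp_mpolyB comp_mpolyD expr2 !compM e0 e1 e2 -expr2 -s2 presalg_pi_relator.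
rewrite r3 comp_mpolyB comp_mpolyD comp_mpolyZ expr2 !compM e0 e1 e3 -expr2.
set b := _ / 2; set c := _ / 2.
(* Reduction modulo the relators of [Dmx v]. The choice of [b] and [c] cancels the coefficients of
   [X0 * X3] and [X1 * X3]; that of [X0 * X1] is (a^2 v - u) / 2, zero by [uE]. *)
have -> : lin4 b c 0 a ^+ 2 - (u *: (X0 * lin4 b c 0 a) + X1 * lin4 b c 0 a)
   = (b ^+ 2 - u * b) *: relator (Dmx v) i0 + (c ^+ 2 - c) *: relator (Dmx v) i1
   + a ^+ 2 *: relator (Dmx v) i3 + (2 * b * c - u * c - b) *: (X0 * X1)
   + (2 * b * a - u * a + a ^+ 2 * v) *: (X0 * X3)
   + (2 * c * a - a + a ^+ 2) *: (X1 * X3).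
  by rewrite s0 s1 s3 /lin4 -!mul_mpolyC; ring.
rewrite (_ : 2 * b * c - u * c - b = 0); last by rewrite /b /c uE; field.
rewrite (_ : 2 * b * a - u * a + a ^+ 2 * v = 0); last by rewrite /b uE; field.
rewrite (_ : 2 * c * a - a + a ^+ 2 = 0); last by rewrite /c; field.
by rewrite !scale0r !addr0 !presalg_piD !presalg_piZ_relator !addr0.
Qed.

Lemma graded_iso_Dmx (u v a : F) : (2 : F) != 0 -> a != 0 -> u = a ^+ 2 * v ->
  graded_iso (Dmx u) (Dmx v).
Proof.
move=> nz2 nz_a uE.
apply: (@graded_iso_subst _ _ _ _ (subst_last u v a) (subst_last v u a^-1)) => i.
- exact: subst_last_dhomog.
- exact: subst_last_relator.
- by apply: subst_last_relator => //; rewrite uE; field.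
- exact: subst_lastK.
- by rewrite -{1}[a]invrK subst_lastK // invr_eq0.
Qed.

End FourGenerators.

Theorem proposition2p9 (F : fieldType) (u v : F) :
  2%N \notin [pchar F] -> u != 0 -> v != 0 -> u != v ->
  (graded_iso (Dmx u) (Dmx v) <-> exists a : F, u / v = a ^+ 2).
Proof.
move=> char2 nz_u nz_v _; have nz2 : (2 : F) != 0 by rewrite inE /= in char2.
split=> [|[a uvE]]; first exact: graded_iso_Dmx_square.
apply: (graded_iso_Dmx (a := a)) => //; last by rewrite -uvE divfK.
by rewrite -sqrf_eq0 -uvE mulf_neq0 ?invr_eq0.
Qed.
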